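(* Let $n,m$ be integers with $m,n\geqslant 7$ (and $m\leqslant n$), let $i_1,\dots,i_m\in[n]$ be distinct and let $j_1,\dots,j_m\in[n]$ be distinct. Then the inequality $$\sum_{r=1}^{m}Y_{i_rj_r,i_rj_r}-\sum_{1\leqslant r<s\leqslant m}Y_{i_rj_r,i_sj_s}\leqslant 1$$ is facet-defining for the QAP-polytope $\mathrm{QAP}_n$.
   Context: For a permutation $\sigma\in S_n$, $P_\sigma$ is the $n\times n$ permutation matrix with $P_\sigma(i,j)=1$ iff $\sigma(i)=j$. Rows and columns of $n^2\times n^2$ matrices are indexed by pairs $(ij)$ with $i,j\in[n]$, and $Y_{ij,kl}$ denotes the entry in row $(ij)$ and column $(kl)$. $P^{[2]}_\sigma$ is the $n^2\times n^2$ matrix with $P^{[2]}_\sigma(ij,kl)=P_\sigma(i,j)\,P_\sigma(k,l)$ (i.e. $yy^T$ for $y$ the vectorization of $P_\sigma$). The QAP-polytope is $\mathrm{QAP}_n=\mathrm{conv}\{P^{[2]}_\sigma:\sigma\in S_n\}$. *)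

(* Defs.v *)
From HB Require Import structures.
From mathcomp Require Import all_boot all_order all_fingroup all_algebra.

Set Implicit Arguments.
Unset Strict Implicit.
Unset Printing Implicit Defensive.

Import Order.TTheory GRing.Theory Num.Theory.
Local Open Scope ring_scope.

Definition affinely_independent (R : realFieldType) (V : lmodType R) (k : nat)
    (x : 'I_k -> V) : Prop :=
  forall c : 'I_k -> R,
    \sum_(a < k) c a = 0 -> \sum_(a < k) c a *: x a = 0 -> forall a, c a = 0.

(* The affine hull of S has dimension d: the maximal number of affinely
   independent points of S is d + 1.  As d : nat, this forces S nonempty. *)
Definition has_affine_dim (R : realFieldType) (V : lmodType R)
    (S : V -> Prop) (d : nat) : Prop :=
  (exists x : 'I_d.+1 -> V, (forall a, S (x a)) /\ affinely_independent x) /\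
  (forall (k : nat) (x : 'I_k -> V),
     (forall a, S (x a)) -> affinely_independent x -> (k <= d.+1)%N).

(* Meant for linear f: the inequality f y <= b is valid on P, and the face it
   induces has dimension dim P - 1. *)
Definition facet_defining (R : realFieldType) (V : lmodType R)
    (P : V -> Prop) (f : V -> R) (b : R) : Prop :=
  (forall y, P y -> f y <= b) /\
  (exists d : nat,
     has_affine_dim P d.+1 /\ has_affine_dim (fun y => P y /\ f y = b) d).

Definition conv_hull (R : realFieldType) (V : lmodType R) (I : finType)
    (v : I -> V) (y : V) : Prop :=
  exists w : I -> R,
    [/\ forall a, 0 <= w a, \sum_a w a = 1 & y = \sum_a w a *: v a].

(* The pair (ij) is encoded as mxvec_index i j : 'I_(n * n), and
   perm_mx s i j = (s i == j)%:R. *)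
Definition perm_mx2 (R : realFieldType) (n : nat) (s : 'S_n) : 'M[R]_(n * n) :=
  (mxvec (perm_mx s))^T *m mxvec (perm_mx s).

Lemma perm_mx2E (R : realFieldType) (n : nat) (s : 'S_n) (i j k l : 'I_n) :
  perm_mx2 R s (mxvec_index i j) (mxvec_index k l)
    = (s i == j)%:R * (s k == l)%:R.
Proof. by rewrite mxE big_ord1 mxE !mxvecE !mxE. Qed.

Definition QAP (R : realFieldType) (n : nat) : 'M[R]_(n * n) -> Prop :=
  conv_hull (@perm_mx2 R n).

(* Main.v *)
Require Import Defs.
From HB Require Import structures.
From mathcomp Require Import all_boot all_order all_fingroup all_algebra.
From mathcomp Require Import ring.

Import Order.TTheory GRing.Theory Num.Theory.
Local Open Scope ring_scope.

(* After relabelling, i_r = j_r; let I be the set of these indices and t(s) the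
   number of fixed points of s in I.  At the vertex of s the left-hand side is
   t - t(t-1)/2 = 1 - (t-1)(t-2)/2, so it is at most 1, with equality iff t is
   1 or 2.  To show that the face has codimension one, let g(s) be the vertex
   of s modulo the span of the vertices of the face.  Since the vertex of s
   only involves s at two indices at a time, the alternating sum of g over the
   cube generated by three permutations with disjoint supports vanishes.

   If X and Y have disjoint supports A, B, and X s, Y s have one fixed point
   in I while s has none, then the third factor of the cube may be changed
   freely: g(s) = g(s') for every s' without fixed points in I that agrees with
   s on A and B.  Fixing A first, contracting it, and arguing by induction on
   the degree (2, then 1, then 0), one gets g(s) = g(s') as soon as s, s' share
   a path q -> p -> x with p in I; these classes overlap enough to make g
   constant, say c, on {t = 0}.  Finally g - (t-1)(t-2)/2 c vanishes for t <= 2,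
   and cubes that break up fixed points show that it vanishes everywhere. *)

Set Implicit Arguments.
Unset Strict Implicit.
Unset Printing Implicit Defensive.

(** * Functions of low degree on permutations; cycles through a given path *)

Section LowDegree.

Variable T : finType.
Implicit Types (W I A : {set T}) (s t X : {perm T}).

(* g is killed by (1 - X_0) ... (1 - X_k) for all X_0, ..., X_k with pairwise
   disjoint supports in W; X * s is s precomposed with X. *)
Fixpoint lowdeg (V : zmodType) (k : nat) W (g : {perm T} -> V) : Prop :=
  if k is k'.+1 then
    forall A X, A \subset W -> perm_on A X ->
      lowdeg k' (W :\: A) (fun s => g s - g (X * s)%g)
  else forall X s, perm_on W X -> g (X * s)%g = g s.

Lemma lowdeg_ext (V : zmodType) k W (g h : {perm T} -> V) :
  g =1 h -> lowdeg k W g -> lowdeg k W h.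
Proof.
elim: k W g h => [|k IHk] W g h gh lg; first by move=> X s XW; rewrite -!gh lg.
move=> A X AW XA; apply: IHk (lg A X AW XA) => s; by rewrite !gh.
Qed.

Lemma lowdeg_mulr (V : zmodType) k W (g : {perm T} -> V) t :
  lowdeg k W g -> lowdeg k W (fun s => g (s * t)%g).
Proof.
elim: k W g => [|k IHk] W g lg.
  move=> X s XW; have -> : (X * s * t = X * (s * t))%g by rewrite mulgA.
  exact: lg.
move=> A X AW XA; apply: lowdeg_ext (IHk _ _ (lg A X AW XA)) => s.
by rewrite mulgA.
Qed.

Lemma lowdeg_additive (U V : zmodType) (F : U -> V) k W (g : {perm T} -> U) :
  {morph F : x y / x - y} -> lowdeg k W g -> lowdeg k W (fun s => F (g s)).
Proof.
move=> FB; elim: k W g => [|k IHk] W g lg; first by move=> X s XW; rewrite lg.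
move=> A X AW XA; apply: lowdeg_ext (IHk _ _ (lg A X AW XA)) => s.
by rewrite FB.
Qed.

Lemma lowdeg_const (V : zmodType) k W (c : V) : lowdeg k W (fun=> c).
Proof. by elim: k W c => [|k IHk] W c. 
Qed.

Lemma lowdeg_mx (R : zmodType) p q k W (g : {perm T} -> 'M[R]_(p, q)) :
  (forall a b, lowdeg k W (fun s => g s a b)) -> lowdeg k W g.
Proof.
elim: k W g => [|k IHk] W g lg.
  by move=> X s XW; apply/matrixP => a b; apply: lg.
move=> A X AW XA; apply: IHk => a b.
by apply: lowdeg_ext (lg a b A X AW XA) => s; rewrite !mxE.
Qed.

(** If A misses S, the difference by X is zero. Otherwise it depends only on s restricted to S
    together with A, and passing from W to W minus A loses a point of S, so induction on k
    applies. *)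
Lemma lowdeg_local (V : zmodType) k W (S : {set T}) (g : {perm T} -> V) :
  (forall s t, {in S, s =1 t} -> g s = g t) -> (#|S :&: W| <= k)%N ->
  lowdeg k W g.
Proof.
elim: k W S g => [|k IHk] W S g locg.
  rewrite leqn0 cards_eq0 => /eqP SW0 X s XW.
  apply: locg => x xS; rewrite permM (out_perm XW) //.
  apply/negP => xW; have := in_set0 x.
  by rewrite -SW0 inE xS xW.
move=> leSk A X AW XA.
have [SA0|] := eqVneq (S :&: A) set0.
  apply: lowdeg_ext (lowdeg_const _ _ 0) => s; apply/esym/eqP; rewrite subr_eq0.
  apply/eqP/locg => x xS; rewrite permM (out_perm XA) //.
  apply/negP => xA; have := in_set0 x.
  by rewrite -SA0 inE xS xA.
case/set0Pn => y /setIP[yS yA].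
apply: (IHk _ (S :|: A)).
  move=> s t st; congr (_ - _); apply: locg => x xS; first by rewrite st ?inE ?xS.
  rewrite !permM st // inE; case: (boolP (x \in A)) => xA.
    by rewrite (perm_closed _ XA) xA orbT.
  by rewrite (out_perm XA) ?xS.
rewrite -ltnS; apply: leq_trans leSk.
apply: proper_card; apply/properP; split.
  by apply/subsetP => x; rewrite !inE => /andP[/orP[->|->]] // /andP[].
by exists y; rewrite !inE ?yS ?yA ?(subsetP AW).
Qed.

Definition fixedIn I s := [set x in I | s x == x].

Definition deranges W I s := perm_on W s && [forall x in I, s x != x].

Lemma derangesP W I s :
  reflect (perm_on W s /\ {in I, forall x, s x != x}) (deranges W I s).
Proof.
apply: (iffP andP) => -[sW sI]; split=> //; last by apply/forall_inP.
by apply/forall_inP: sI.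
Qed.

Lemma deranges_fixed0 W I s : deranges W I s -> fixedIn I s = set0.
Proof.
case/derangesP=> _ sI; apply/setP => x; rewrite !inE.
by case: (boolP (x \in I)) => //= /sI/negPf.
Qed.

Lemma derange_cycle W (c : seq T) :
  (1 < #|W|)%N -> uniq c -> {subset c <= W} ->
  exists t, [/\ perm_on W t, {in W, forall x, t x != x} & sorted (frel t) c].
Proof.
move=> W1 Uc sub_c; pose c' := c ++ [seq x <- enum W | x \notin c].
have Uc' : uniq c'.
  rewrite cat_uniq Uc filter_uniq ?enum_uniq // andbT -all_predC.
  by apply/allP => x; rewrite mem_filter => /andP[].
have mem_c' : c' =i W.
  move=> x; rewrite mem_cat mem_filter mem_enum.
  by case: (boolP (x \in c)) => //= /sub_c ->.
pose t := perm (can_inj (prev_next Uc')).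
have tE x : t x = next c' x by rewrite permE.
have size_c' : (1 < size c')%N by rewrite -(card_uniqP Uc') (eq_card mem_c').
have cyc : fcycle t c'.
  have := cycle_next Uc'; rewrite (@eq_cycle _ _ (frel t)) // => x y /=.
  by rewrite tE.
exists t; split.
- apply/subsetP => x; rewrite inE tE -mem_c'; apply: contraR => xc'.
  by rewrite next_nth (negPf xc').
- move=> x; rewrite -mem_c' => xc'; rewrite tE.
  have [i u rot_c'] := rot_to xc'.
  rewrite -(next_rot i Uc') rot_c'.
  have : size (x :: u) = size c' by rewrite -rot_c' size_rot.
  have : uniq (x :: u) by rewrite -rot_c' rot_uniq.
  case: u {rot_c'} => [|y u] /=; first by move=> _ E; rewrite -E in size_c'.
  by rewrite eqxx inE negb_or eq_sym => /andP[/andP[]].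
- have : sorted (frel t) c'.
    by move: cyc; case: (c') => //= a l; rewrite rcons_path => /andP[].
  by rewrite /c' => /cat_sorted2[].
Qed.

End LowDegree.

(** * Rigidity: constancy on the permutations without fixed points in I *)

Section Rigidity.

Variables (T : finType) (V : zmodType).
Implicit Types (W I A B : {set T}) (s t u X P : {perm T}) (g : {perm T} -> V).

(** For k = 2 and W everything, these are the permutations whose vertices lie on the face.
    Subtracting the translate by an X that creates one fixed point lowers both this bound and the
    degree by one, so [rigid] uses the same k for both. *)
Definition vanishes k W I g :=
  forall s, perm_on W s -> (0 < #|fixedIn I s| <= k)%N -> g s = 0.

Definition rigid k W I :=
  forall g, lowdeg k W g -> vanishes k W I g ->
  forall s s', deranges W I s -> deranges W I s' -> g s = g s'.

Lemma rigid0 W I : rigid 0 W I.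
Proof.
move=> g lg _ s s' /derangesP[sW _] /derangesP[s'W _].
by rewrite -[s]mulg1 -[s']mulg1 !lg.
Qed.

(* Every u agreeing with s on A is replaced by u * P, which is the identity on
   A and has the same fixed points in the smaller set of indices. *)
Lemma deranges_agree k W I A s s' X P g :
  A \subset W -> perm_on A X -> #|fixedIn I (X * s)%g| = 1%N ->
  perm_on (A :|: s @: A) P -> {in A, forall a, P (s a) = a} ->
  rigid k (W :\: A) (I :\: (A :|: s @: A)) ->
  lowdeg k.+1 W g -> vanishes k.+1 W I g ->
  deranges W I s -> deranges W I s' -> {in A, s' =1 s} -> g s = g s'.
Proof.
move=> AW XA X1 PA Ps rig lg vg /derangesP[sW sI] /derangesP[s'W s'I] s's.
set B := A :|: s @: A in PA rig.
have BW : B \subset W.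
  rewrite subUset AW; apply/subsetP => _ /imsetP[a aA ->].
  by rewrite perm_closed // (subsetP AW).
have XW : perm_on W X by apply: subset_trans XA AW.
have PW : perm_on W P by apply: subset_trans PA BW.
(* Composing with P turns u into the identity on A. Points of [s @: A] leave the index set: by
   injectivity u fixes none of them that is in I, whereas [u * P] might. *)
have fixP u : perm_on W u -> {in A, u =1 s} ->
  [/\ perm_on (W :\: A) (u * P)%g, fixedIn I u = fixedIn (I :\: B) (u * P)%g &
     #|fixedIn I (X * u)%g| = #|fixedIn (I :\: B) (u * P)%g|.+1].
  move=> uW us.
  have fixu : fixedIn I u = fixedIn (I :\: B) (u * P)%g.
    apply/setP => x; rewrite !inE permM.
    case: (boolP (x \in I)) => xI; rewrite /= ?andbF //.
    case: (boolP (x \in A)) => xA /=; first by rewrite us // (negPf (sI _ xI)).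
    case: imsetP => [[a aA xa]|xsA] /=.
      apply/negbTE/eqP => ux; move: xA; rewrite -(_ : a = x) ?aA //.
      by apply: (@perm_inj _ u); rewrite us // -xa.
    have Px : P x = x by rewrite (out_perm PA) // !inE (negPf xA); apply/imsetP.
    apply/eqP/eqP => [->//|Pux].
    by apply: (@perm_inj _ P); rewrite Pux.
  split=> //.
    apply/subsetP => x; rewrite !inE permM; apply: contraR.
    rewrite negb_and negbK => /orP[xA|xW]; first by rewrite us // Ps.
    by rewrite (out_perm uW) // (out_perm PW).
  (* The fixed point of [X * s] in I lies in A, where u agrees with s; those of u lie outside A,
     where X is trivial. *)
  have -> : fixedIn I (X * u)%g = fixedIn I (X * s)%g :|: fixedIn I u.
    apply/setP => x; rewrite !inE !permM.
    case: (boolP (x \in I)) => xI //=; case: (boolP (x \in A)) => xA.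
      rewrite (us (X x)) ?perm_closed // (us x) //.
      by rewrite (negPf (sI _ xI)) orbF.
    by rewrite (out_perm XA) // (negPf (sI _ xI)).
  rewrite cardsU X1 -fixu (_ : _ :&: _ = set0) ?cards0 ?subn0 //.
  apply/setP => x; rewrite !inE !permM.
  case: (boolP (x \in I)) => xI //=; case: (boolP (x \in A)) => xA.
    by rewrite (us x) // (negPf (sI _ xI)) andbF.
  by rewrite (out_perm XA) // (negPf (sI _ xI)).
pose g1 (w : {perm T}) := g (w * P^-1)%g - g (X * (w * P^-1))%g.
have lg1 : lowdeg k (W :\: A) g1 by apply: lowdeg_mulr (lg A X AW XA).
have vg1 : vanishes k (W :\: A) (I :\: B) g1.
  move=> w wWA /andP[t0 tk]; rewrite /g1; set u := (w * _)%g.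
  have uW : perm_on W u.
    by rewrite perm_onM ?perm_onV //; apply: subset_trans wWA (subsetDl _ _).
  have us : {in A, u =1 s}.
    move=> a aA; rewrite permM (out_perm wWA) ?inE ?aA //.
    by rewrite -{1}(Ps a aA) permK.
  have [_ E1 E2] := fixP u uW us.
  have uP : (u * P)%g = w by rewrite /u -mulgA mulVg mulg1.
  rewrite uP in E1 E2.
  rewrite (vg u uW) ?E1 ?t0 ?leqW // (vg (X * u)%g) ?subrr ?E2 //.
  exact: perm_onM.
(* Here [X * u] has exactly one fixed point in I, so g vanishes there and the difference is
   [g u]. *)
have vX u : deranges W I u -> {in A, u =1 s} -> g1 (u * P)%g = g u.
  move=> du us; have /derangesP[uW _] := du; have [_ E1 E2] := fixP u uW us.
  rewrite /g1 -mulgA mulgV mulg1 (vg (X * u)%g) ?subr0 ?perm_onM //.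
  by rewrite E2 -E1 (deranges_fixed0 du) cards0.
have dP u : deranges W I u -> {in A, u =1 s} ->
    deranges (W :\: A) (I :\: B) (u * P)%g.
  move=> du us; have /derangesP[uW _] := du; have [uP E _] := fixP u uW us.
  apply/derangesP; split=> // x xI; apply/eqP => ux.
  have : x \in fixedIn (I :\: B) (u * P)%g by rewrite inE xI ux eqxx.
  by rewrite -E (deranges_fixed0 du) inE.
have ds : deranges W I s by apply/derangesP.
have ds' : deranges W I s' by apply/derangesP.
by rewrite -(vX s) // -(vX s') //; apply: rig => //; apply: dP.
Qed.

Lemma leq_card_seq B (c : seq T) : {subset B <= c} -> (#|B| <= size c)%N.
Proof. by move=> /subsetP/subset_leq_card Bc; apply: leq_trans Bc (card_size c). Qed.

Lemma exists_notin (Z : {set T}) (c : seq T) : (size c < #|Z|)%N ->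
  exists2 x, x \in Z & x \notin c.
Proof.
move=> lt_c; suff /subsetPn[x xZ xc] : ~~ (Z \subset [set x in c]).
  by exists x => //; rewrite inE in xc.
apply: contraL lt_c => /subset_leq_card le_Z; rewrite -leqNgt.
by apply: leq_trans le_Z _; rewrite cardsE card_size.
Qed.

(** * Connecting any two paths through permutations that contain several *)

Section Connectivity.

Variables (W I : {set T}) (g : {perm T} -> V).
Hypotheses (W5 : (5 <= #|W|)%N) (I4 : (4 <= #|I|)%N) (IW : I \subset W).

Hypothesis g_path : forall s s' q p,
  deranges W I s -> deranges W I s' -> p \in I ->
  s q = p -> s' q = p -> s' p = s p -> s p != q -> g s = g s'.

(* The common value of g on the deranging permutations containing the path
   a -> b -> c. *)
Let val a b c : V := g (odflt 1%g
  [pick t | [&& deranges W I t, t a == b & t b == c]]).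

Let val_deranges s a b c : deranges W I s -> b \in I -> s a = b -> s b = c ->
  c != a -> g s = val a b c.
Proof.
move=> ds bI sa sb ca; rewrite /val; case: pickP => [t /and3P[dt /eqP ta /eqP tb]|].
  by apply: (g_path ds dt bI sa ta) => //; rewrite ?sb ?tb.
by move/(_ s); rewrite ds sa sb !eqxx.
Qed.

Let derange_through (c : seq T) : uniq c && all [in W] c ->
  exists t, deranges W I t /\ sorted (frel t) c.
Proof.
case/andP=> Uc /allP cW; have W1 : (1 < #|W|)%N by apply: leq_trans W5.
have [t [tW dt st]] := derange_cycle W1 Uc cW.
by exists t; split=> //; apply/derangesP; split=> // x xI; rewrite dt ?(subsetP IW).
Qed.

Ltac distinct := rewrite /= ?inE ?negb_or ?andbT;
  repeat (apply/andP; split);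
  first [assumption | rewrite eq_sym; assumption | apply: (subsetP IW); assumption].

(** Both values are attained at one permutation running through all the points; [val_jump] does the
    same for two paths that share only an endpoint. *)
Let val_shift a b c d : a != b -> a != c -> a != d -> b != c -> b != d -> c != d ->
  a \in W -> b \in I -> c \in I -> d \in W -> val a b c = val b c d.
Proof.
move=> ab ac ad bc bd cd aW bI cI dW.
have [|t [dt /= /and4P[/eqP ta /eqP tb /eqP tc _]]] :=
  @derange_through [:: a; b; c; d]; first by distinct.
by rewrite -(val_deranges dt bI ta tb) 1?eq_sym // -(val_deranges dt cI tb tc) 1?eq_sym.
Qed.

Let val_jump a b c d e : a != b -> a != c -> a != d -> a != e -> b != c ->
  b != d -> b != e -> c != d -> c != e -> d != e ->
  a \in W -> b \in I -> c \in W -> d \in I -> e \in W -> val a b c = val c d e.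
Proof.
move=> ab ac ad ae bc bd be cd ce de aW bI cW dI eW.
have [|t [dt /= /and5P[/eqP ta /eqP tb /eqP tc /eqP td _]]] :=
  @derange_through [:: a; b; c; d; e]; first by distinct.
by rewrite -(val_deranges dt bI ta tb) 1?eq_sym // -(val_deranges dt dI tc td) 1?eq_sym.
Qed.

(** Shifting around the cycle z, w, x, y leads from z -> w -> x to x -> y -> z, which can be
    continued by z -> w -> v as well as by z -> v -> w. *)
Let val_core z w x y v : z != w -> z != x -> z != y -> z != v -> w != x ->
  w != y -> w != v -> x != y -> x != v -> y != v ->
  z \in W -> w \in I -> x \in I -> y \in I -> v \in I ->
  [/\ val w x y = val z w x, val z w x = val z w v & val z w v = val z v w].
Proof.
move=> *.
have E1 : val z w x = val w x y by apply: val_shift; distinct.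
have E2 : val w x y = val x y z by apply: val_shift; distinct.
have E3 : val x y z = val z w v by apply: val_jump; distinct.
have E4 : val x y z = val z v w by apply: val_jump; distinct.
by split; rewrite ?E1 ?E2 -?E4.
Qed.

(** The values are compared through paths that start at an auxiliary z in W; it need not be in I,
    which may consist of a, b, c, d alone. *)
Let val_replace a b c d : a != b -> a != c -> a != d -> b != c -> b != d ->
  c != d -> a \in I -> b \in I -> c \in I -> d \in I ->
  [/\ val a b c = val d b c, val a b c = val b a c & val a b c = val b c a].
Proof.
move=> *; have [z zW] : exists2 z, z \in W & z \notin [:: a; b; c; d].
  exact: exists_notin.
rewrite !inE !negb_or => /and4P[*].
have [abc dab da] : [/\ val a b c = val z a b, val z a b = val z a d
    & val z a d = val z d a].
  by apply: (@val_core _ _ _ c); distinct.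
have [dbc db _] : [/\ val d b c = val z d b, val z d b = val z d a
    & val z d a = val z a d].
  by apply: (@val_core _ _ _ c); distinct.
have [bac bad bd] : [/\ val b a c = val z b a, val z b a = val z b d
    & val z b d = val z d b].
  by apply: (@val_core _ _ _ c); distinct.
have [bca bcd _] : [/\ val b c a = val z b c, val z b c = val z b d
    & val z b d = val z d b].
  by apply: (@val_core _ _ _ a); distinct.
by split; congruence.
Qed.

Let val_sym a b c : a != b -> a != c -> b != c ->
  a \in I -> b \in I -> c \in I ->
  val a b c = val b a c /\ val a b c = val b c a.
Proof.
move=> *.
have [d dI] : exists2 d, d \in I & d \notin [:: a; b; c] by exact: exists_notin.
rewrite !inE !negb_or => /and3P[*].
by have [] : [/\ val a b c = val d b c, val a b c = val b a c & val a b c = val b c a];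
  first by apply: val_replace; distinct.
Qed.

Let val_first x a b c : a != b -> a != c -> b != c ->
  a \in I -> b \in I -> c \in I -> x \in I ->
  exists b' c', [/\ [&& x != b', x != c' & b' != c'], b' \in I, c' \in I
                  & val a b c = val x b' c'].
Proof.
move=> ab ac bc aI bI cI xI.
have [bac bca] : val a b c = val b a c /\ val a b c = val b c a.
  by apply: val_sym; distinct.
have [_ cab] : val b c a = val c b a /\ val b c a = val c a b.
  by apply: val_sym; distinct.
have [->|xa] := eqVneq x a; first by exists b, c; split=> //; distinct.
have [->|xb] := eqVneq x b; first by exists a, c; split=> //; distinct.
have [->|xc] := eqVneq x c.
  by exists a, b; split=> //; [distinct | congruence].
exists b, c; split=> //; first by distinct.
by have [] : [/\ val a b c = val x b c, val a b c = val b a c & val a b c = val b c a];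
  first by apply: val_replace; distinct.
Qed.

Let val_last x y c c' : x != y -> x != c -> y != c -> x != c' -> y != c' ->
  x \in I -> y \in I -> c \in I -> c' \in I -> val x y c = val x y c'.
Proof.
move=> *; have [->//|?] := eqVneq c c'.
have [_ <-] : val c x y = val x c y /\ val c x y = val x y c.
  by apply: val_sym; distinct.
have [_ <-] : val c' x y = val x c' y /\ val c' x y = val x y c'.
  by apply: val_sym; distinct.
by have [] : [/\ val c x y = val c' x y, val c x y = val x c y & val c x y = val x y c];
  first by apply: val_replace; distinct.
Qed.

Let val_second x y b c : x != b -> x != c -> b != c -> x != y ->
  x \in I -> b \in I -> c \in I -> y \in I ->
  exists c', [/\ x != c', y != c', c' \in I & val x b c = val x y c'].
Proof.
move=> xb xc bc xy xI bI cI yI.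
have swap c' : x != c' -> b != c' -> c' \in I -> val x b c' = val x c' b.
  move=> *; have [-> _] : val x b c' = val b x c' /\ val x b c' = val b c' x.
    by apply: val_sym; distinct.
  have [_ ->//] : val b x c' = val x b c' /\ val b x c' = val x c' b.
  by apply: val_sym; distinct.
have [->|yb] := eqVneq y b; first by exists c; split.
exists b; split=> //.
by rewrite -swap //; try distinct; apply: val_last; distinct.
Qed.

Let val_const a b c a' b' c' : a != b -> a != c -> b != c ->
  a' != b' -> a' != c' -> b' != c' ->
  a \in I -> b \in I -> c \in I -> a' \in I -> b' \in I -> c' \in I ->
  val a b c = val a' b' c'.
Proof.
move=> ab ac bc ab' ac' bc' aI bI cI aI' bI' cI'.
have [b1 [c1 [/and3P[ab1 ac1 bc1] b1I c1I ->]]] := val_first ab ac bc aI bI cI aI'.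
have [c2 [ac2 bc2 c2I ->]] : exists c2,
    [/\ a' != c2, b' != c2, c2 \in I & val a' b1 c1 = val a' b' c2].
  by apply: val_second; distinct.
by apply: val_last; distinct.
Qed.

Let val_inner a b c : a != b -> a != c -> b != c ->
  a \in W -> b \in I -> c \in W ->
  exists a' b' c', [/\ [&& a' != b', a' != c' & b' != c'],
    a' \in I, b' \in I, c' \in I & val a b c = val a' b' c'].
Proof.
move=> ab ac bc aW bI cW.
have [d dI] : exists2 d, d \in I & d \notin [:: a; b; c] by exact: exists_notin.
rewrite !inE !negb_or => /and3P[da db dc].
have [cI|cI] := boolP (c \in I).
  exists b, c, d; split=> //; first by distinct.
  by apply: val_shift; distinct.
have I3 : (3 < #|I :\ c|)%N by move: I4; rewrite (cardsD1 c) (negPf cI).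
have [e] : exists2 e, e \in I :\ c & e \notin [:: a; b; d].
  exact: exists_notin.
rewrite !inE !negb_or => /andP[ec eI] /and3P[ea eb ed].
(* f may coincide with a or b: it enters only after the path c -> d -> e has been reached. *)
have [f] : exists2 f, f \in I :\ c & f \notin [:: d; e].
  by apply: exists_notin; apply: ltnW.
rewrite !inE !negb_or => /andP[fc fI] /andP[fd fe].
exists d, e, f; split=> //; first by distinct.
have -> : val a b c = val c d e by apply: val_jump; distinct.
by apply: val_shift; distinct.
Qed.

Lemma deranges_path_const s s' q q' :
  deranges W I s -> deranges W I s' ->
  s q \in I -> s (s q) != q -> s' q' \in I -> s' (s' q') != q' -> g s = g s'.
Proof.
have inner t r : deranges W I t -> t r \in I -> t (t r) != r ->
  exists a b c, [/\ [&& a != b, a != c & b != c],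
    a \in I, b \in I, c \in I & g t = val a b c].
  move=> dt trI ttr; have /derangesP[tW tI] := dt.
  have ttr' : t (t r) != t r by apply: tI.
  have rtr : t r != r by apply: contraNneq ttr' => E; rewrite !E.
  have rW : r \in W by rewrite -(perm_closed _ tW) (subsetP IW).
  have ttW : t (t r) \in W by rewrite !(perm_closed _ tW).
  have [a [b [c [abc aI bI cI E]]]] : exists a b c,
      [/\ [&& a != b, a != c & b != c], a \in I, b \in I, c \in I
        & val r (t r) (t (t r)) = val a b c].
    by apply: val_inner; distinct.
  by exists a, b, c; split=> //; rewrite -E; apply: val_deranges.
move=> ds ds' sq ssq sq' ssq'.
have [a [b [c [/and3P[ab ac bc] aI bI cI ->]]]] := inner s q ds sq ssq.
have [a' [b' [c' [/and3P[ab' ac' bc'] aI' bI' cI' ->]]]] := inner s' q' ds' sq' ssq'.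
exact: val_const.
Qed.

End Connectivity.

(** * Induction on the degree *)

(* A path q -> p -> x with x <> q is shared by fixing the set A = {q, p}.  If s
   is an involution on I there is no such path; then A = {q, p, w}, for two
   2-cycles (q p) and (w y) of s, relates s to a permutation that has one. *)
Lemma rigid_succ k W I : (5 <= #|W|)%N -> (4 <= #|I|)%N -> I \subset W ->
  (forall A B, A \subset B -> (#|A| <= 2)%N -> (#|B| <= 3)%N ->
     rigid k (W :\: A) (I :\: B)) ->
  (forall s, deranges W I s -> {in I, forall p, s (s p) = p} ->
     exists2 p, p \in I & forall A B, A \subset B -> (#|A| <= 3)%N ->
       (#|B| <= 4)%N -> p \in B -> s p \in B -> rigid k (W :\: A) (I :\: B)) ->
  rigid k.+1 W I.
Proof.
move=> W5 I4 IW rig2 rig3 g lg vg.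
have fix1 s X p : (forall u : T, u \in I -> s (X u) = u <-> u = p) -> p \in I ->
    #|fixedIn I (X * s)%g| = 1%N.
  move=> E pI; rewrite -(cards1 p); congr #|pred_of_set _|; apply/setP => u.
  rewrite !inE permM; case: (boolP (u \in I)) => uI /=.
    by apply/eqP/eqP => /(E u uI).
  by apply/esym/negbTE; apply: contraNneq uI => ->.
have g_path s s' q p : deranges W I s -> deranges W I s' -> p \in I ->
    s q = p -> s' q = p -> s' p = s p -> s p != q -> g s = g s'.
  move=> ds ds' pI sq s'q s'p spq; have /derangesP[sW sI] := ds.
  have pq : p != q by apply: contraNneq (sI _ pI) => pq; rewrite {1}pq sq.
  have xp := sI _ pI; have pW := subsetP IW _ pI.
  have qW : q \in W by rewrite -(perm_closed _ sW) sq.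
  have sA : s @: [set q; p] = [set p; s p].
    by rewrite imsetU1 imset_set1 sq.
  (* Swapping q and p before s makes p a fixed point, while q goes to s p <> q. The second
     permutation sends s q = p back to q and s p back to p. *)
  apply: (@deranges_agree k W I [set q; p] s s' (tperm q p)
           (tperm p q * tperm p (s p))%g) => //.
  - by rewrite subUset !sub1set qW.
  - exact: tperm_on.
  - apply: (fix1 _ _ p) => // u uI; split=> [|->]; last by rewrite tpermR.
    case: tpermP => [->/eqP|->|_ _ /eqP]; first by rewrite (negPf spq).
      by [].
    by rewrite (negPf (sI _ uI)).
  - rewrite sA; apply: perm_onM; apply: subset_trans (tperm_on _ _) _;
    by rewrite !subUset !sub1set !inE !eqxx ?orbT.
  - move=> a; rewrite !inE permM => /orP[] /eqP->.
      by rewrite sq tpermL tpermD // eq_sym.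
    by rewrite (@tpermD _ p q) 1?eq_sym // tpermR.
  - rewrite sA; apply: rig2; first exact: subsetUl.
      by apply: (@leq_card_seq _ [:: q; p]) => u; rewrite !inE.
    apply: (@leq_card_seq _ [:: q; p; s p]) => u; rewrite !inE.
    by case: (u == q); case: (u == p); case: (u == s p).
  by move=> a; rewrite !inE => /orP[] /eqP->; rewrite ?sq ?s'q.
have good s : deranges W I s -> exists s' q,
    [/\ deranges W I s', s' q \in I, s' (s' q) != q & g s = g s'].
  move=> ds; have /derangesP[sW sI] := ds.
  have [inv|] := boolP [forall p in I, s (s p) == p]; last first.
    (* If s (s p) <> p, the predecessor of p starts the required path in s itself. *)
    case/forall_inPn => p pI ssp; exists s, (s^-1%g p).
    rewrite permKV; split=> //; apply: contraNneq ssp => ->.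
    by rewrite permKV.
  have {}inv : {in I, forall p, s (s p) = p}.
    by move=> p pI; apply/eqP; apply: (forall_inP inv).
  have [p pI rig] := rig3 s ds inv.
  have [q sp] : exists q, s p = q by exists (s p).
  rewrite sp in rig.
  have sq : s q = p by rewrite -sp inv.
  have qp : q != p by rewrite -sp sI.
  have [y yI] : exists2 y, y \in I & y \notin [:: p; q].
    by apply: exists_notin; apply: leq_trans I4.
  rewrite !inE negb_or => /andP[yp yq].
  have [w sy] : exists w, s y = w by exists (s y).
  have sw : s w = y by rewrite -sy inv.
  have wy : w != y by rewrite -sy sI.
  have wp : w != p by apply: contraNneq yq => wp; rewrite -sw wp sp.
  have wq : w != q by apply: contraNneq yp => wp'; rewrite -sw wp' sq.
  have [z zW] : exists2 z, z \in W & z \notin [:: p; q; w; y].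
    exact: exists_notin.
  rewrite !inE !negb_or => /and4P[zp zq zw zy].
  have pW := subsetP IW _ pI; have yW := subsetP IW _ yI.
  have qW : q \in W by rewrite -(perm_closed _ sW) sq.
  have wW : w \in W by rewrite -(perm_closed _ sW) sw.
  pose s' := (tperm y z * s)%g.
  have s'y : s' y = s z by rewrite permM tpermL.
  have s'D (u : T) : y != u -> z != u -> s' u = s u.
    by move=> yu zu; rewrite permM tpermD.
  have ds' : deranges W I s'.
    apply/derangesP; split.
      apply: perm_onM sW; apply: subset_trans (tperm_on _ _) _.
      by rewrite subUset !sub1set yW.
    move=> u uI; rewrite permM; case: tpermP => [->|->|_ _]; last exact: sI.
      by rewrite -sw (inj_eq perm_inj).
    by rewrite sy eq_sym.
  have s'w : s' w = y by rewrite s'D // eq_sym.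
  exists s', w; rewrite s'w s'y; split=> //.
    by rewrite -sy (inj_eq perm_inj).
  have sA : s @: [set q; p; w] = [set p; q; y].
    by rewrite !imsetU !imset_set1 sq sp sw.
  (* Swapping q and p alone would fix both; with this 3-cycle before s, p is fixed, but q goes to y
     and w to q. *)
  apply: (@deranges_agree k W I [set q; p; w] s s'
           (tperm p q * tperm p w)%g (tperm q p * tperm w y)%g) => //.
  - by rewrite !subUset !sub1set qW pW wW.
  - apply: perm_onM; apply: subset_trans (tperm_on _ _) _;
    by rewrite !subUset !sub1set !inE !eqxx ?orbT.
  - apply: (fix1 _ _ p) => // u uI; rewrite permM; split=> [|->]; last first.
      by rewrite tpermL tpermD // eq_sym.
    have [->//|up] := eqVneq u p.
    have [->|uq] := eqVneq u q.
      by rewrite tpermR tpermL sw => /eqP; rewrite (negPf yq).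
    rewrite (@tpermD _ p q u) 1?eq_sym //.
    have [->|uw] := eqVneq u w.
      by rewrite tpermR sp => /eqP; rewrite eq_sym (negPf wq).
    by rewrite tpermD 1?eq_sym // => /eqP; rewrite (negPf (sI _ uI)).
  - rewrite sA; apply: perm_onM; apply: subset_trans (tperm_on _ _) _;
    by rewrite !subUset !sub1set !inE !eqxx ?orbT.
  - move=> a; rewrite !inE permM -orbA => /or3P[] /eqP->.
    + by rewrite sq tpermR tpermD // eq_sym.
    + by rewrite sp tpermL tpermD // eq_sym.
    by rewrite sw (@tpermD _ q p) 1?eq_sym // tpermR.
  - rewrite sA; apply: rig; rewrite ?subsetUl ?inE ?eqxx ?orbT //.
      apply: (@leq_card_seq _ [:: q; p; w]) => u; rewrite !inE.
      by case: (u == q); case: (u == p); case: (u == w).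
    apply: (@leq_card_seq _ [:: q; p; w; y]) => u; rewrite !inE.
    by case: (u == q); case: (u == p); case: (u == w); case: (u == y).
  by move=> a; rewrite !inE -orbA => /or3P[] /eqP->; rewrite s'D // eq_sym.
move=> s s' ds ds'.
have [t [q [dt tq ttq ->]]] := good s ds.
have [t' [q' [dt' tq' ttq' ->]]] := good s' ds'.
exact: (@deranges_path_const W I g W5 I4 IW g_path t t' q q').
Qed.

Lemma rigid1 W I : (5 <= #|W|)%N -> (4 <= #|I|)%N -> I \subset W -> rigid 1 W I.
Proof.
move=> W5 I4 IW; apply: rigid_succ => // [A B _ _ _|s _ _]; first exact: rigid0.
have [p pI _] := @exists_notin I [::] (ltn_trans (isT : 0 < 3)%N I4).
by exists p => // A B *; apply: rigid0.
Qed.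

(* 7 is odd, while the orbits of s in I have two elements. *)
Lemma involution_card8 I s : (7 <= #|I|)%N ->
  {in I, forall p, [/\ s p \in I, s p != p & s (s p) = p]} -> (8 <= #|I|)%N.
Proof.
move=> I7 inv.
have pick2 (c : seq T) : {in c, forall x, s x \in c} -> (size c < 7)%N -> uniq c ->
    {subset c <= I} -> exists p, let c' := [:: p, s p & c] in
    [/\ uniq c', {subset c' <= I} & {in c', forall x, s x \in c'}].
  move=> sc c7 Uc cI; have [p pI pc] := exists_notin (leq_trans c7 I7).
  have [spI spp ssp] := inv p pI.
  have spc : s p \notin c by apply: contra pc => /sc; rewrite ssp.
  exists p; split=> /=; first by rewrite inE negb_or eq_sym spp pc spc.
    by move=> x; rewrite !inE => /or3P[/eqP->|/eqP->|/cI].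
  by move=> x; rewrite !inE => /or3P[/eqP->|/eqP->|/sc->]; rewrite ?ssp ?eqxx ?orbT.
have [//|//|//|//|p1 [U1 I1 s1]] := pick2 [::].
have [p2 [U2 I2 s2]] := pick2 _ s1 isT U1 I1.
have [p3 [U3 I3 s3]] := pick2 _ s2 isT U2 I2.
have [p4 [U4 I4 s4]] := pick2 _ s3 isT U3 I3.
have := uniq_leq_size U4 (_ : {subset _ <= enum I}); rewrite -cardE.
by apply=> x /I4; rewrite mem_enum.
Qed.

Lemma leq_cardsD a b A B : (a + b <= #|A|)%N -> (#|B| <= b)%N ->
  (a <= #|A :\: B|)%N.
Proof.
move=> Aab Bb; rewrite cardsD -(leq_add2r b); apply: leq_trans Aab _.
rewrite addnC -leq_subLR leq_sub2l //.
by apply: leq_trans (subset_leq_card (subsetIr _ _)) Bb.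
Qed.

(** [rigid1] needs 5 points in W and 4 in I; removing 2 and 3 points from 7 and 7 leaves just these.
    In the involutive case 3 and 4 points go, which is harmless if I has 8 elements. If I has 7,
    parity gives p in I with s p outside I: then W has at least 8 points, and at most 3 of the
    points of B lie in I. *)
Lemma rigid2 W I : (7 <= #|W|)%N -> (7 <= #|I|)%N -> I \subset W -> rigid 2 W I.
Proof.
move=> W7 I7 IW; apply: rigid_succ => //;
  try exact: leq_trans I7; try exact: leq_trans W7.
  move=> A B AB A2 B3; apply: rigid1; last by rewrite setDSS.
    exact: leq_cardsD A2.
  exact: leq_cardsD B3.
move=> s /derangesP[sW sI] inv.
have [I8|I8] := leqP 8 #|I|.
  have [p pI _] := @exists_notin I [::] (leq_trans (isT : 0 < 7)%N I7).
  exists p => // A B AB A3 B4 _ _; apply: rigid1; last by rewrite setDSS.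
    apply: (@leq_cardsD 5 3) => //.
    exact: leq_trans I8 (subset_leq_card IW).
  exact: (@leq_cardsD 4 4).
have [stab|/forall_inPn[p pI spI]] := boolP [forall p in I, s p \in I].
  case/negP: (ltn_geF I8); apply: (@involution_card8 I s) => // p pI.
  by rewrite inv // sI // (forall_inP stab).
exists p => // A B AB A3 B4 pB spB; apply: rigid1; last by rewrite setDSS.
  apply: leq_cardsD A3; apply: leq_ltn_trans I7 (proper_card _).
  apply/properP; split=> //; exists (s p) => //.
  by rewrite perm_closed // (subsetP IW).
have -> : I :\: B = I :\: (B :\ s p).
  apply/setP => x; rewrite !inE; case: (eqVneq x (s p)) => [->|] //=.
  by rewrite (negPf spI) andbF.
by apply: (@leq_cardsD 4 3) => //; move: B4; rewrite (cardsD1 (s p)) spB.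
Qed.

End Rigidity.

(** * From at most two fixed points to all permutations *)

Section Vanishing.

Variables (T : finType) (I : {set T}).
Implicit Types (s : {perm T}).

(** The composite sends q to p and p to s q, which differs from s p = p; so no fixed point is
    created, even when q is in I. *)
Lemma fixedIn_tperm s p q : p \in fixedIn I s -> q != p ->
  (#|fixedIn I (tperm p q * s)%g| < #|fixedIn I s|)%N.
Proof.
rewrite inE => /andP[pI /eqP sp] qp; apply/proper_card/properP; split; last first.
  exists p; rewrite !inE pI ?sp ?eqxx //= permM tpermL -{1}sp.
  by rewrite (inj_eq perm_inj).
apply/subsetP => x; rewrite !inE permM => /andP[-> /eqP].
case: tpermP => [->|->|_ _ ->]; last by rewrite eqxx.
  by move=> sq; move: qp; rewrite -(inj_eq (@perm_inj _ s)) sq sp eqxx.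
by rewrite sp => pq; rewrite pq eqxx in qp.
Qed.

Lemma fixedIn_tpermD s p q r : r \in fixedIn I s -> p != r -> q != r ->
  r \in fixedIn I (tperm p q * s)%g.
Proof. by rewrite !inE permM => rs pr qr; rewrite tpermD. Qed.

(* Swapping three fixed points with three other points only decreases the
   number of fixed points, so the cube relation determines the values by
   induction on that number. *)
Lemma lowdeg2_eq0 (V : zmodType) (h : {perm T} -> V) : (6 <= #|T|)%N ->
  lowdeg 2 [set: T] h -> (forall s, (#|fixedIn I s| <= 2)%N -> h s = 0) ->
  forall s, h s = 0.
Proof.
move=> T6 lh h2 s.
have [m] := ubnP #|fixedIn I s|; elim: m s => // m IHm s.
rewrite ltnS => sm; have [/h2//|s3] := leqP #|fixedIn I s| 2.
have {}IHm s' : (#|fixedIn I s'| < #|fixedIn I s|)%N -> h s' = 0.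
  by move=> s's; apply: IHm; apply: leq_trans sm.
have new c : (size c < 6)%N -> exists q : T, q \notin c.
  move=> c6; have [|q _ qc] := @exists_notin T [set: T] c; last by exists q.
  by rewrite cardsT; apply: leq_trans T6.
have [p1 f1 _] := @exists_notin _ (fixedIn I s) [::] (ltn_trans (isT : 0 < 2)%N s3).
have [p2 f2] := @exists_notin _ (fixedIn I s) [:: p1] (ltn_trans (isT : 1 < 2)%N s3).
rewrite !inE => p21.
have [p3 f3] := @exists_notin _ (fixedIn I s) [:: p1; p2] s3.
rewrite !inE negb_or => /andP[p31 p32].
have [q1] := new [:: p1; p2; p3] isT.
rewrite !inE !negb_or => /and3P[q1p1 q1p2 q1p3].
have [q2] := new [:: p1; p2; p3; q1] isT.
rewrite !inE !negb_or => /and4P[q2p1 q2p2 q2p3 q21].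
have [q3] := new [:: p1; p2; p3; q1; q2] isT.
rewrite !inE !negb_or => /and5P[q3p1 q3p2 q3p3 q31 q32].
have A2 : [set p2; q2] \subset [set: T] :\: [set p1; q1].
  by rewrite subUset !sub1set !inE !negb_or p21 q2p1 q21 (eq_sym p2) q1p2.
have A3 : perm_on ([set: T] :\: [set p1; q1] :\: [set p2; q2]) (tperm p3 q3).
  apply: subset_trans (tperm_on _ _) _; rewrite subUset !sub1set !inE !negb_or.
  by rewrite p31 p32 q3p1 q3p2 q31 q32 !(eq_sym p3) q1p3 q2p3.
have := lh _ _ (subsetT _) (tperm_on p1 q1) _ _ A2 (tperm_on p2 q2) _ s A3.
set X1 := tperm p1 q1; set X2 := tperm p2 q2; set X3 := tperm p3 q3.
have f23 : p2 \in fixedIn I (X3 * s)%g by apply: fixedIn_tpermD.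
have f13 : p1 \in fixedIn I (X3 * s)%g by apply: fixedIn_tpermD.
have f12 : p1 \in fixedIn I (X2 * s)%g by apply: fixedIn_tpermD; rewrite // eq_sym.
have f123 : p1 \in fixedIn I (X2 * (X3 * s))%g.
  by apply: fixedIn_tpermD; rewrite // eq_sym.
have t3 := fixedIn_tperm f3 q3p3; have t2 := fixedIn_tperm f2 q2p2.
have t1 := fixedIn_tperm f1 q1p1.
have t23 := ltn_trans (fixedIn_tperm f23 q2p2) t3.
have t13 := ltn_trans (fixedIn_tperm f13 q1p1) t3.
have t12 := ltn_trans (fixedIn_tperm f12 q1p1) t2.
have t123 := ltn_trans (fixedIn_tperm f123 q1p1) t23.
(* The other seven corners of the cube have fewer fixed points than s, so the cube relation leaves h
   s = 0. *)
rewrite (IHm _ t1) (IHm _ t2) (IHm _ t3) (IHm _ t12) (IHm _ t13).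
rewrite (IHm _ t23) (IHm _ t123).
by rewrite !subr0 => <-.
Qed.

End Vanishing.

(** * Affine dimension and facets through linear spans *)

Section AffineDimension.

Variables (R : realFieldType) (vT : vectType R).

Lemma free_subset (X : seq vT) :
  exists Y, [/\ {subset Y <= X}, free Y & <<Y>>%VS = <<X>>%VS].
Proof.
elim: X => [|x X [Y [YX fY sY]]]; first by exists [::]; rewrite nil_free.
have [xY|xY] := boolP (x \in <<Y>>%VS).
  exists Y; split=> //; first by move=> y /YX; rewrite inE orbC => ->.
  by rewrite span_cons -sY; apply/esym/addv_idPr; rewrite -memvE.
exists (x :: Y); split; last by rewrite !span_cons sY.
  by move=> y; rewrite !inE => /orP[->//|/YX->]; rewrite orbT.
by rewrite free_cons xY.
Qed.

Lemma scalar_sum (l : vT -> R) (J : finType) (c : J -> R) (x : J -> vT) :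
  scalar l -> l (\sum_a c a *: x a) = \sum_a c a * l (x a).
Proof.
move=> lin; pose L : {scalar vT} := HB.pack l (GRing.isLinear.Build _ _ _ _ l lin).
rewrite -[l]/(L : vT -> R) linear_sum; apply: eq_bigr => a _.
exact: scalarZ.
Qed.

Lemma scalar_at0 (l : vT -> R) : scalar l -> l 0 = 0.
Proof. by move=> lin; have := lin (-1) 0 0; rewrite scaler0 addr0 mulN1r addNr. Qed.

(** A linear form equal to 1 on S makes affine and linear independence the same for points of S, so
    the affine dimension is the dimension of the span minus one. *)
Lemma has_affine_dim_span (l : vT -> R) (S : vT -> Prop) (X : seq vT) d :
  scalar l -> (forall y, S y -> l y = 1) -> (forall x, x \in X -> S x) ->
  (forall y, S y -> y \in <<X>>%VS) -> \dim <<X>> = d.+1 ->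
  has_affine_dim S d.
Proof.
move=> lin l1 XS SX dimX; split.
  have [Y [YX fY sY]] := free_subset X.
  have sizeY : size Y = d.+1 by rewrite -dimX -sY (eqP fY).
  pose y := Tuple (introT eqP sizeY); exists (fun a => y`_a); split.
    by move=> a; apply/XS/YX/mem_nth; rewrite sizeY.
  by have /freeP fy : free y := fY; move=> c _; apply: fy.
move=> k x xS aff; pose t := [tuple x a | a < k].
have tE (a : 'I_k) : t`_a = x a by rewrite -tnth_nth tnth_mktuple.
have ft : free t.
  apply/freeP => c c0; apply: aff; last first.
    by rewrite -[RHS]c0; apply: eq_bigr => a _; rewrite tE.
  have : l (\sum_(a < k) c a *: x a) = 0.
    rewrite (_ : \sum_(a < k) _ = 0); last first.
      by rewrite -[RHS]c0; apply: eq_bigr => a _; rewrite tE.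
    exact: scalar_at0.
  rewrite scalar_sum // => E; rewrite -[RHS]E.
  by apply: eq_bigr => a _; rewrite l1 ?mulr1.
have <- : size t = k by rewrite size_tuple.
rewrite -(eqP ft) -dimX; apply: dimvS; apply/span_subvP => _ /mapP[a _ ->].
exact: SX.
Qed.

(** The vertices with f = 1 span F, and F with [v a0] spans all vertices. As l and f agree on F but
    not at [v a0], the two spans differ by exactly one dimension. *)
Lemma facet_of_span (J : finType) (v : J -> vT) (l f : vT -> R) (a0 a1 : J) :
  scalar l -> scalar f -> (forall a, l (v a) = 1) -> (forall a, f (v a) <= 1) ->
  f (v a0) != 1 -> f (v a1) = 1 ->
  (forall a, v a \in (<<[seq v b | b in [pred b | f (v b) == 1]]>> + <[v a0]>)%VS) ->
  facet_defining (conv_hull v) f 1.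
Proof.
move=> lin_l lin_f l1 f1 fa0 fa1.
set XF := image v _; set F := <<XF>>%VS => vF.
pose XA := codom v.
have conv_v a : conv_hull v (v a).
  exists (fun b => (b == a)%:R); split=> [b||]; first exact: ler0n.
    by rewrite (bigD1 a) //= eqxx big1 ?addr0 // => b /negPf->.
  rewrite (bigD1 a) //= eqxx scale1r big1 ?addr0 // => b /negPf->.
  by rewrite scale0r.
have l_conv y : conv_hull v y -> l y = 1.
  case=> w [_ w1 ->]; rewrite scalar_sum // -[RHS]w1.
  by apply: eq_bigr => a _; rewrite l1 mulr1.
have XFP x : reflect (exists2 a, f (v a) = 1 & x = v a) (x \in XF).
  apply: (iffP imageP) => [[a]|[a fa ->]]; last by exists a; rewrite // inE fa eqxx.
  by rewrite inE => /eqP fa ->; exists a.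
have lF y : y \in F -> l y = f y.
  rewrite /F -[XF]/(tval (in_tuple XF)) => /coord_span->.
  rewrite !scalar_sum //; apply: eq_bigr => a _; congr (_ * _).
  have /XFP[b fb ->] : XF`_a \in XF by apply: mem_nth.
  by rewrite l1 fb.
have v0F : v a0 \notin F.
  by apply: contra fa0 => /lF; rewrite l1 => <-.
have spanA : <<XA>>%VS = (F + <[v a0]>)%VS.
  apply/eqP; rewrite eqEsubv subv_add -memvE memv_span ?codom_f // andbT.
  apply/andP; split; first by apply/span_subvP => _ /codomP[a ->].
  by apply: sub_span => x /XFP[a _ ->]; apply: codom_f.
have dimA : \dim <<XA>> = (\dim F).+1.
  have [Y [_ fY sY]] := free_subset XF.
  rewrite spanA addvC /F -sY -span_cons (eqP fY) (eqP (_ : free (v a0 :: Y))) //.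
  by rewrite free_cons sY v0F.
have v1F : v a1 \in F by apply: memv_span; apply/XFP; exists a1.
(* F contains [v a1], where l is 1, so F is nonzero and its dimension is a successor. *)
have [d dimF] : exists d, \dim F = d.+1.
  case E: (\dim F) => [|d]; last by exists d.
  have : \dim F == 0%N by rewrite E.
  rewrite dimv_eq0 => /eqP F0; move: v1F; rewrite F0 memv0 => /eqP v10.
  have := l1 a1; rewrite v10.
  by move/eqP; rewrite scalar_at0 // eq_sym oner_eq0.
split.
  move=> _ [w [w0 w1 ->]]; rewrite scalar_sum // -[leRHS]w1.
  by apply: ler_sum => a _; rewrite -[leRHS]mulr1 ler_wpM2l.
exists d; split.
  apply: (has_affine_dim_span (X := XA) lin_l l_conv).
  - by move=> x /codomP[a ->].
  - move=> _ [w [_ _ ->]]; apply: memv_suml => a _.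
    by rewrite memvZ // memv_span // codom_f.
  by rewrite dimA dimF.
apply: (has_affine_dim_span (X := XF) lin_l) => //.
- by move=> y [/l_conv].
- by move=> x /XFP[a fa ->].
move=> _ [[w [w0 w1 ->]]]; rewrite scalar_sum // => fy.
apply: memv_suml => a _; have [fa|fa] := eqVneq (f (v a)) 1.
  by rewrite memvZ // memv_span //; apply/XFP; exists a.
suff -> : w a = 0 by rewrite scale0r mem0v.
(* The slacks 1 - f are nonnegative with weighted sum 0, so a vertex off the face has weight 0. *)
have E : \sum_a w a * (1 - f (v a)) = 0.
  under eq_bigr do rewrite mulrBr mulr1.
  by rewrite sumrB w1 fy subrr.
have := psumr_eq0P _ E => /(_ _ a isT)/eqP; rewrite mulf_eq0 subr_eq0 eq_sym.
rewrite (eq_sym 1) (negPf fa) orbF => H; apply/eqP; rewrite eq_sym H // => b _.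
by rewrite mulr_ge0 ?subr_ge0.
Qed.

End AffineDimension.

(** * The QAP-polytope and its facet *)

Lemma sqr_sum_ord (R : comNzRingType) m (x : 'I_m -> R) :
  (\sum_r x r) ^+ 2 =
  \sum_r x r ^+ 2 + (\sum_(r < m) \sum_(s < m | (r < s)%N) x r * x s) *+ 2.
Proof.
have lt : \sum_(r < m) \sum_(s < m | (s < r)%N) x r * x s =
          \sum_(r < m) \sum_(s < m | (r < s)%N) x r * x s.
  rewrite (exchange_big_dep xpredT) //=.
  by apply: eq_bigr => r _; apply: eq_bigr => s _; rewrite mulrC.
rewrite expr2 big_distrlr /= mulr2n -{1}lt -!big_split /=; apply: eq_bigr => r _.
rewrite (bigD1 r) //= -expr2; congr (_ + _).
rewrite (bigID (fun s : 'I_m => (s < r)%N)) /=; congr (_ + _); apply: eq_bigl => s.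
  by rewrite -val_eqE /=; case: ltngtP.
by rewrite -val_eqE /=; case: ltngtP.
Qed.

(** Induct on the list of indices, correcting P by a transposition; injectivity of i and j preserves
    the values already prescribed. *)
Lemma perm_extend (T : finType) m (i j : 'I_m -> T) :
  injective i -> injective j -> exists P : {perm T}, forall r, P (i r) = j r.
Proof.
move=> hi hj; suff [P PE] : exists P : {perm T},
    forall r, r \in enum 'I_m -> P (i r) = j r.
  by exists P => r; rewrite PE ?mem_enum.
elim: (enum 'I_m) (enum_uniq 'I_m) => [|r c IHc] /=; first by exists 1%g.
case/andP=> rc /IHc[P PE]; exists (P * tperm (P (i r)) (j r))%g => k.
rewrite inE permM => /predU1P[->|kc]; first by rewrite tpermL.
have rk : r != k by apply: contraNneq rc => ->.
rewrite tpermD; first exact: PE.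
  by rewrite (inj_eq perm_inj) (inj_eq hi).
by rewrite PE // (inj_eq hj).
Qed.

(** The entry (ij, kl) depends on s only through s i and s k. *)
Lemma perm_mx2_lowdeg (R : realFieldType) n : lowdeg 2 setT (@perm_mx2 R n).
Proof.
apply: lowdeg_mx => a b; case/mxvec_indexP: a => i j; case/mxvec_indexP: b => k l.
apply: (@lowdeg_local _ _ _ _ [set i; k]) => [s t st|].
  by rewrite !perm_mx2E !st // !inE eqxx ?orbT.
by rewrite setIT cards2; case: (_ != _).
Qed.

Unset Implicit Arguments.

Theorem theorem2 (R : realFieldType) (n m : nat)
    (hm : (7 <= m)%N) (hn : (7 <= n)%N) (hmn : (m <= n)%N)
    (i j : 'I_m -> 'I_n) (hi : injective i) (hj : injective j) :
  facet_defining (@QAP R n)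
    (fun Y : 'M[R]_(n * n) =>
       \sum_(r < m) Y (mxvec_index (i r) (j r)) (mxvec_index (i r) (j r))
       - \sum_(r < m) \sum_(s < m | (r < s)%N)
           Y (mxvec_index (i r) (j r)) (mxvec_index (i s) (j s)))
    1.
Proof.
set f := fun Y : 'M[R]_(n * n) => _.
have [P PE] := perm_extend hi hj.
pose I := i @: [set: 'I_m].
have cardI : #|I| = m by rewrite card_imset // cardsT card_ord.
(* [w s] is the vertex of [s * P], which maps [i r] to [j r] exactly when s fixes [i r]. *)
pose v := @perm_mx2 R n; pose w (s : 'S_n) := v (s * P)%g.
have f_scalar : scalar f.
  move=> c u u'; rewrite /f mulrBr !mulr_sumr addrACA -opprD -!big_split /=.
  congr (_ - _); apply: eq_bigr => r _; first by rewrite !mxE.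
  by rewrite mulr_sumr -big_split; apply: eq_bigr => s _; rewrite !mxE.
(* Doubled to avoid division; for 0/1 variables the square of the sum determines the sum over
   pairs. *)
have fE s : f (w s) *+ 2 = 2 - (#|fixedIn I s|%:R - 1) * (#|fixedIn I s|%:R - 2).
  pose x r : R := (s (i r) == i r)%:R.
  have wE r t : w s (mxvec_index (i r) (j r)) (mxvec_index (i t) (j t)) = x r * x t.
    by rewrite perm_mx2E !permM -!PE !(inj_eq perm_inj).
  have xx r : x r ^+ 2 = x r by rewrite /x; case: (_ == _); rewrite ?expr1n ?expr0n.
  have -> : #|fixedIn I s|%:R = \sum_r x r.
    have -> : fixedIn I s = i @: [set r | s (i r) == i r].
      apply/setP => y; rewrite inE; apply/andP/imsetP => [[/imsetP[r _ ->] sr]|].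
        by exists r; rewrite ?inE.
      by case=> r; rewrite inE => sr ->; rewrite imset_f ?inE.
    rewrite card_imset // -sum1dep_card natr_sum big_mkcond /=.
    by apply: eq_bigr => r _; rewrite /x; case: (_ == _).
  have -> : f (w s) = \sum_r x r - \sum_(r < m) \sum_(t < m | (r < t)%N) x r * x t.
    rewrite /f; congr (_ - _); first by apply: eq_bigr => r _; rewrite wE -expr2 xx.
    by apply: eq_bigr => r _; apply: eq_bigr => t _; rewrite wE.
  have := sqr_sum_ord x; rewrite (eq_bigr _ (fun r _ => xx r)).
  set S := \sum_r x r; set S2 := \sum_r _ => E.
  by rewrite mulrnBl -[S2 *+ 2](addKr S) -E; ring.
have f_le1 s : f (w s) <= 1.
  rewrite -(ler_pMn2r (isT : 0 < 2)%N) fE -[leRHS]subr0 lerB //.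
  case: #|_| => [|[|k]]; rewrite ?subrr ?mul0r // ?sub0r ?mulrNN ?mulr_ge0 //.
    by rewrite subr_ge0 ler1n.
  by rewrite subr_ge0 ler_nat.
have f_eq1 s : (f (w s) == 1) = (0 < #|fixedIn I s| <= 2)%N.
  rewrite -(inj_eq (pmulrnI (isT : 0 < 2)%N)) fE -[eqbRHS]subr0 (inj_eq (addrI _)).
  rewrite eqr_opp mulf_eq0 !subr_eq0 eqr_nat -[1]/(1%:R) eqr_nat.
  by case: #|_| => [|[|[|k]]].
have T7 : (7 <= #|[set: 'I_n]|)%N by rewrite cardsT card_ord.
have T1 : (1 < #|[set: 'I_n]|)%N by apply: leq_trans T7.
(* s0 moves every point, so its vertex is off the face; s1 below fixes only x0, so its vertex is on
   it. *)
have [//|s0 [s0T s0D _]] := @derange_cycle _ _ [::] T1 isT.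
have ds0 : deranges setT I s0 by apply/derangesP; split=> // x _; rewrite s0D.
have [x0 x0I] : exists x, x \in I.
  by apply/card_gt0P; rewrite cardI; apply: leq_trans hm.
have C1 : (1 < #|[set~ x0]|)%N.
  by rewrite cardsC1 card_ord -ltnS prednK; apply: leq_trans hn.
have [//|s1 [s1x s1D _]] := @derange_cycle _ _ [::] C1 isT.
have fix1 : fixedIn I s1 = [set x0].
  apply/setP => x; rewrite !inE; have [->|xx0] := eqVneq x x0.
    by rewrite x0I (out_perm s1x) ?eqxx // !inE eqxx.
  by rewrite (negPf (s1D _ _)) ?andbF // !inE.
(* The linear form that is 1 on all vertices: s maps x0 to exactly one k. *)
pose l (Y : 'M[R]_(n * n)) := \sum_k Y (mxvec_index x0 k) (mxvec_index x0 k).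
have l_scalar : scalar l.
  move=> c u u'; rewrite /l mulr_sumr -big_split.
  by apply: eq_bigr => k _; rewrite !mxE.
have l1 s : l (v s) = 1.
  rewrite /l (bigD1 (s x0)) //= perm_mx2E eqxx mulr1 big1 ?addr0 // => k.
  by rewrite perm_mx2E eq_sym => /negPf->; rewrite mul0r.
have vw s : v s = w (s * P^-1)%g by rewrite /w mulgKV.
apply: (@facet_of_span _ _ _ v l f (s0 * P)%g (s1 * P)%g) => //.
- by move=> s; rewrite vw.
- by rewrite -/(w s0) f_eq1 (deranges_fixed0 ds0) cards0.
- by apply/eqP; rewrite -/(w s1) f_eq1 fix1 cards1.
set F := <<_>>%VS => s.
have wF s' : (0 < #|fixedIn I s'| <= 2)%N -> w s' \in F.
  rewrite -f_eq1 => fs'; apply/memv_span/imageP.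
  by exists (s' * P)%g.
(* The quotient by F, realised as a projection with kernel F. *)
pose pr := (\1 - projv F)%VF.
have prE u : pr u = u - projv F u by rewrite !lfun_simp.
have prF u : u \in F -> pr u = 0 by move=> uF; rewrite prE projv_id ?subrr.
have lw : lowdeg 2 setT w by apply: lowdeg_mulr; apply: perm_mx2_lowdeg.
have w0 s' : fixedIn I s' = set0 -> pr (w s') = pr (w s0).
  move=> fs'.
  apply: (@rigid2 _ _ setT I _ _ (subsetT _) (fun s => pr (w s))) => //.
  - by rewrite cardI.
  - by apply: (@lowdeg_additive _ _ _ pr) => // u u'; rewrite linearB.
  - by move=> t _ /wF/prF.
  apply/derangesP; split=> [|x xI]; first by apply/subsetP.
  apply/eqP => sx; have := in_set0 x.
  by rewrite -fs' inE xI sx eqxx.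
(* At a vertex with t fixed points in I, l - f is (t - 1)(t - 2)/2. Being linear in the matrix, h
   inherits the cube relation from w. *)
pose h u := pr u - (l u - f u) *: pr (w s0).
have hw : h (w (s * P^-1)%g) = 0.
  apply: (@lowdeg2_eq0 _ I _ (fun s => h (w s))).
  - by rewrite card_ord; apply: leq_trans hn.
  - apply: lowdeg_additive lw => u u'.
    have zB (g : 'M[R]_(n * n) -> R) : scalar g -> g (u - u') = g u - g u'.
      by move=> gs; rewrite -scaleN1r addrC gs mulN1r addrC.
    rewrite /h linearB /= !zB //.
    have -> : l u - l u' - (f u - f u') = l u - f u - (l u' - f u') by ring.
    by rewrite [(_ - (l u' - _)) *: _]scalerBl !opprD !opprK addrACA.
  (* Without fixed points in I the coefficient l - f is 1; with one or two it is 0 and the vertex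
     lies in F. *)
  move=> t t2; rewrite /h l1; have [/cards0_eq t0|t0] := posnP #|fixedIn I t|.
    have /eqP : f (w t) *+ 2 = 0 by rewrite fE t0 cards0; ring.
    by rewrite mulrn_eq0 /= => /eqP->; rewrite subr0 scale1r w0 ?subrr.
  have t12 : (0 < #|fixedIn I t| <= 2)%N by rewrite t0.
  move: (t12); rewrite -f_eq1 => /eqP->.
  by rewrite prF ?wF // subrr scale0r subrr.
rewrite vw; move: hw; set y := w _; rewrite /h; set k := l y - f y => hy.
have /eqP : pr (y - k *: w s0) = 0 by rewrite linearB linearZ.
rewrite prE subr_eq0 => /eqP yF.
rewrite -[y](subrK (k *: w s0)) memv_add ?memvZ ?memv_line //.
by rewrite yF memv_proj.
Qed.
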